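(* Let $n>2$, fix $B=(b_{ij})\in U(n)$, and let $$\psi_\lambda^{(B)}(x)=\Big(\sum_{k=0}^nA_k^{(B)}(\lambda)\chi_{J_k}(x)\Big)e_\lambda(x),\quad\lambda\in\mathbb{R},$$ be the generalized eigenfunction satisfying the boundary condition $B\,(\psi^{(B)}_\lambda(\beta_1),\dots,\psi^{(B)}_\lambda(\beta_n))^T=(\psi^{(B)}_\lambda(\alpha_1),\dots,\psi^{(B)}_\lambda(\alpha_n))^T$. Then $(A_0^{(B)}(\lambda),\dots,A_n^{(B)}(\lambda))$ is a solution to $$B_{\alpha,\beta}(\lambda)\begin{pmatrix}A_0^{(B)}(\lambda)\\ \vdots\\ A_{n-1}^{(B)}(\lambda)\end{pmatrix}=\begin{pmatrix}A_1^{(B)}(\lambda)\\ \vdots\\ A_n^{(B)}(\lambda)\end{pmatrix}.\qquad( * )$$ Moreover, write $B_{\alpha,\beta}(\lambda)=\begin{pmatrix}\boldsymbol u(\lambda)&B'_{\alpha,\beta}(\lambda)\\ c(\lambda)&\boldsymbol w(\lambda)^*\end{pmatrix}$ with $\boldsymbol u(\lambda),\boldsymbol w(\lambda)\in\mathbb{C}^{n-1}$, $c(\lambda)\in\mathbb{C}$, and set $\Lambda_p=\{\lambda\in\mathbb{R}:\det(I_{n-1}-B'_{\alpha,\beta}(\lambda))=0\}$. Then the solutions to $( * )$ are as follows. (1) If $\Lambda_p=\emptyset$, then $B_{\alpha,\beta}(\lambda)$ is non-degenerate, and $$\begin{pmatrix}A_0^{(B)}(\lambda)\\ \vdots\\ A_n^{(B)}(\lambda)\end{pmatrix}=x_0\begin{pmatrix}1\\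 (I_{n-1}-B'_{\alpha,\beta}(\lambda))^{-1}\boldsymbol u(\lambda)\\ c(\lambda)+\langle\boldsymbol w(\lambda),(I_{n-1}-B'_{\alpha,\beta}(\lambda))^{-1}\boldsymbol u(\lambda)\rangle\end{pmatrix}\qquad( ** )$$ for some constant $x_0\in\mathbb{C}$. The points $\lambda\in\Lambda_p$ are the real poles in the functions $A_j^{(B)}$ from $( ** )$. (2) Suppose $\Lambda_p\neq\emptyset$. For all $\lambda\in\Lambda_p$, $B_{\alpha,\beta}(\lambda)$ is degenerate, and there is $\boldsymbol\zeta(\lambda)\in\mathbb{C}^{n-1}\setminus\{0\}$ such that $\boldsymbol\zeta(\lambda)\in\ker(I_{n-1}-B'_{\alpha,\beta}(\lambda))$. Then: (a) If $\boldsymbol u(\lambda)$ is not in the range of $I_{n-1}-B'_{\alpha,\beta}(\lambda)$, $$\begin{pmatrix}A_0^{(B)}(\lambda)\\ \vdots\\ A_n^{(B)}(\lambda)\end{pmatrix}=\begin{pmatrix}0\\ \boldsymbol\zeta(\lambda)\\ \langle\boldsymbol w(\lambda),\boldsymbol\zeta(\lambda)\rangle\end{pmatrix};$$ (b) If $\boldsymbol u(\lambda)$ is in the range of $I_{n-1}-B'_{\alpha,\beta}(\lambda)$ and $(I_{n-1}-B'_{\alpha,\beta}(\lambda))\boldsymbol\zeta_0(\lambda)=\boldsymbol u(\lambda)$, $$\begin{pmatrix}A_0^{(B)}(\lambda)\\ \vdots\\ A_n^{(B)}(\lambda)\end{pmatrix}=x_0\begin{pmatrix}1\\ \boldsymbol\zeta_0(\lambda)\\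 c(\lambda)+\langle\boldsymbol w(\lambda),\boldsymbol\zeta_0(\lambda)\rangle\end{pmatrix}+\begin{pmatrix}0\\ \boldsymbol\zeta(\lambda)\\ \langle\boldsymbol w(\lambda),\boldsymbol\zeta(\lambda)\rangle\end{pmatrix}$$ for some constant $x_0\in\mathbb{C}$. In particular, $\Lambda_p$ consists of eigenvalues for $P_B$.
   Context: Notation: $e_\lambda(x)=e^{i2\pi\lambda x}$; inner products are linear in the second variable, so $\langle\boldsymbol w,\boldsymbol v\rangle=\boldsymbol w^*\boldsymbol v$. Fix $-\infty<\beta_1<\alpha_1<\beta_2<\alpha_2<\cdots<\beta_n<\alpha_n<\infty$ and put $J_0=(-\infty,\beta_1)$, $J_k=(\alpha_k,\beta_{k+1})$ for $1\le k\le n-1$, $J_n=(\alpha_n,\infty)$, $\Omega=\bigcup_{k=0}^nJ_k$. Values at $\beta_i$ are limits from the left, values at $\alpha_i$ limits from the right. $B_{\alpha,\beta}(\lambda)=D_\alpha(\lambda)^*BD_\beta(\lambda)$ with $D_\alpha(\lambda)=\mathrm{diag}(e_\lambda(\alpha_1),\dots,e_\lambda(\alpha_n))$ and $D_\beta(\lambda)=\mathrm{diag}(e_\lambda(\beta_1),\dots,e_\lambda(\beta_n))$; its $(i,j)$ entry is $b_{ij}e_\lambda(\beta_j-\alpha_i)$. Thus $c(\lambda)=b_{n1}e_\lambda(\beta_1-\alpha_n)$, $\boldsymbol u(\lambda)$ has entries $b_{i1}e_\lambda(\beta_1-\alpha_i)$ ($1\le i\le n-1$), the row $\boldsymbol w(\lambda)^*$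 has entries $b_{n,j+1}e_\lambda(\beta_{j+1}-\alpha_n)$ ($1\le j\le n-1$), and $B'_{\alpha,\beta}(\lambda)$ is the upper right $(n-1)\times(n-1)$ corner, with entries $b_{i,j+1}e_\lambda(\beta_{j+1}-\alpha_i)$ ($1\le i,j\le n-1$). An element $C=\begin{pmatrix}\boldsymbol u&C'\\ c&\boldsymbol w^*\end{pmatrix}\in U(n)$ is called degenerate if $1$ is an eigenvalue of its $(n-1)\times(n-1)$ corner $C'$, and non-degenerate otherwise. $P_B=\frac{1}{i2\pi}\frac{d}{dx}$ is the selfadjoint operator in $L^2(\Omega)$ with domain the set of $f\in L^2(\Omega)$, absolutely continuous on components with $f'\in L^2(\Omega)$, and $B(f(\beta_1),\dots,f(\beta_n))^T=(f(\alpha_1),\dots,f(\alpha_n))^T$.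
   Formalization: ''Λ_p are the real poles of the A_j'' fails when Λ_p≠∅ (b_{i,i+1}=b_{n1}=1, else 0: no poles, 0∈Λ_p), so it is stated only for Λ_p=∅; in general, poles of the A_j lie in Λ_p, and Λ_p is the set of real poles of the entries of (I-B'_{α,β}(λ))^{-1}. *)

(* Defs.v *)
From HB Require Import structures.
From mathcomp Require Import all_boot all_order all_algebra.
From mathcomp Require Import complex.
From mathcomp Require Import all_classical all_reals all_analysis.

Set Implicit Arguments.
Unset Strict Implicit.
Unset Printing Implicit Defensive.

Import Order.TTheory GRing.Theory Num.Theory.
Import numFieldNormedType.Exports.

Local Open Scope classical_set_scope.
Local Open Scope ring_scope.
Local Open Scope complex_scope.
Local Open Scope sesquilinear_scope.

(* Matrix sizes are written m.+1 (= n in the mathematics, so that m = n - 1);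
   the indices 1..n of the points alpha_i, beta_i become 0..m. *)

Section Definitions.
Variable R : realType.
Implicit Types (lambda x : R) (f g : R -> R[i]).

Definition e lambda x : R[i] :=
  cos (2 * pi * lambda * x) +i* sin (2 * pi * lambda * x).

Definition inner m (w v : 'cV[R[i]]_m) : R[i] := (w^t* *m v) 0 0.

(* R[i] carries its topology through its regular algebra R[i]^o. *)
Definition cvg_left f x (l : R[i]) : Prop :=
  (f : R -> R[i]^o) y @[y --> x^'-] --> (l : R[i]^o).

Definition cvg_right f x (l : R[i]) : Prop :=
  (f : R -> R[i]^o) y @[y --> x^'+] --> (l : R[i]^o).

(* For f the restriction to the real line of a meromorphic function, this says
   that f has a pole (of order k.+1) at x. *)
Definition real_pole f x : Prop :=
  exists (k : nat) (l : R[i]), l != 0 /\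
    (((y - x)%:C ^+ k.+1 * f y : R[i]^o) @[y --> x^'] --> (l : R[i]^o)).

Section Geometry.
Variables (m : nat) (alpha beta : 'I_m.+1 -> R).

Definition interlaced : Prop :=
  (forall i, beta i < alpha i) /\
  (forall i j : 'I_m.+1, j = i.+1 :> nat -> alpha i < beta j).

(* J ord0 = ]-oo, beta_1[, J ord_max = ]alpha_n, +oo[, and otherwise
   J k = ]alpha_k, beta_(k+1)[ (1-based endpoints). *)
Definition J (k : 'I_m.+2) : interval R :=
  Interval (if unlift ord0 k is Some i then BRight (alpha i) else -oo%O)
           (if unlift ord_max k is Some i then BLeft (beta i) else +oo%O).

Definition Omega : set R := \bigcup_(k : 'I_m.+2) [set` J k].

Definition psi (A : 'cV[R[i]]_m.+2) lambda x : R[i] :=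
  (\sum_k A k 0 * (x \in J k)%:R) * e lambda x.

Definition boundary_condition (B : 'M[R[i]]_m.+1) f : Prop :=
  exists fbeta falpha : 'cV[R[i]]_m.+1,
    [/\ forall i, cvg_left f (beta i) (fbeta i 0),
        forall i, cvg_right f (alpha i) (falpha i 0) &
        B *m fbeta = falpha].

Definition square_integrable f : Prop :=
  [/\ measurable_fun Omega (fun x => complex.Re (f x)),
      measurable_fun Omega (fun x => complex.Im (f x)) &
      (\int[@lebesgue_measure R]_(x in Omega) ((ComplexField.Normc.normc (f x)) ^+ 2)%:E < +oo)%E].

Definition abs_continuous (I : interval R) f : Prop :=
  forall eps : R, 0 < eps -> exists2 delta : R, 0 < delta &
    forall (N : nat) (a b : 'I_N -> R),
      (forall i, [/\ a i \in I, b i \in I & a i <= b i]) ->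
      (forall i j, i != j -> b i <= a j \/ b j <= a i) ->
      \sum_i (b i - a i) < delta ->
      \sum_i ComplexField.Normc.normc (f (b i) - f (a i)) < eps.

Definition ae_derivative f g : Prop :=
  {ae @lebesgue_measure R, forall x, Omega x ->
    is_derive x 1 (fun y => complex.Re (f y)) (complex.Re (g x)) /\
    is_derive x 1 (fun y => complex.Im (f y)) (complex.Im (g x))}.

Definition PB_domain (B : 'M[R[i]]_m.+1) f : Prop :=
  [/\ square_integrable f,
      forall k, abs_continuous (J k) f,
      exists2 f', square_integrable f' & ae_derivative f f' &
      boundary_condition B f].

(* g = P_B f in L^2(Omega); elements of L^2 are represented by functions, and
   those of the domain by their absolutely continuous representative. *)
Definition PB_graph (B : 'M[R[i]]_m.+1) f g : Prop :=
  PB_domain B f /\ ae_derivative f (fun x => (2 * pi)%:C * 'i * g x).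

Definition PB_eigenvalue (B : 'M[R[i]]_m.+1) lambda : Prop :=
  exists f, [/\ PB_graph B f (fun x => lambda%:C * f x) &
    ~ {ae @lebesgue_measure R, forall x, Omega x -> f x = 0}].

Definition D (t : 'I_m.+1 -> R) lambda : 'M[R[i]]_m.+1 :=
  diag_mx (\row_i e lambda (t i)).

Definition Bab (B : 'M[R[i]]_m.+1) lambda : 'M[R[i]]_m.+1 :=
  (D alpha lambda)^t* *m B *m D beta lambda.

(* row' ord_max A = (A_0, ..., A_(n-1)) and row' ord0 A = (A_1, ..., A_n). *)
Definition solution (B : 'M[R[i]]_m.+1) lambda (A : 'cV[R[i]]_m.+2) : Prop :=
  Bab B lambda *m row' ord_max A = row' ord0 A.

End Geometry.

(* The blocks of C = (u C' ; c w^* ), C' being the upper right corner. *)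
Section Blocks.
Variable m : nat.
Implicit Type C : 'M[R[i]]_m.+1.

Definition corner C : 'M[R[i]]_m := row' ord_max (col' ord0 C).
Definition ublock C : 'cV[R[i]]_m := row' ord_max (col ord0 C).
Definition cblock C : R[i] := C ord_max ord0.
Definition wblock C : 'cV[R[i]]_m := (row ord_max (col' ord0 C))^t*.

Definition degenerate C : Prop := C \is unitarymx /\ eigenvalue (corner C) 1.
Definition non_degenerate C : Prop :=
  C \is unitarymx /\ ~~ eigenvalue (corner C) 1.

(* The column (x, v, y) in C^(n+1) = C x C^(n-1) x C. *)
Definition stack (x : R[i]) (v : 'cV[R[i]]_m) (y : R[i]) : 'cV[R[i]]_m.+2 :=
  \col_k (if unlift ord0 k is Some k' then
            if unlift ord_max k' is Some i then v i 0 else y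
          else x).

End Blocks.

Section Spectrum.
Variables (m : nat) (alpha beta : 'I_m.+1 -> R) (B : 'M[R[i]]_m.+1).

Definition Lambda_p : set R :=
  [set lambda | \det (1%:M - corner (Bab alpha beta B lambda)) = 0].

End Spectrum.

(* Only meaningful when 1 - corner C is invertible (invmx is total). *)
Definition resolvent_vector m (C : 'M[R[i]]_m.+1) (a : R[i]) :
    'cV[R[i]]_m.+2 :=
  let v := invmx (1%:M - corner C) *m ublock C in
  a *: stack 1 v (cblock C + inner (wblock C) v).

End Definitions.

(* Main.v *)
Require Import Defs.
From HB Require Import structures.
From mathcomp Require Import all_boot all_order all_algebra.
From mathcomp Require Import complex.
From mathcomp Require Import all_classical all_reals all_analysis.
From mathcomp Require Import ring measurable_realfun.

Set Implicit Arguments.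
Unset Strict Implicit.
Unset Printing Implicit Defensive.

Import Order.TTheory GRing.Theory Num.Theory.
Import numFieldNormedType.Exports.

Local Open Scope classical_set_scope.
Local Open Scope ring_scope.
Local Open Scope complex_scope.

(* Block elimination turns ( * ) into (1 - B') v = x u, y = c x + <w, v>, which
   gives the description of its solutions.

   Conjugating 1 - B'(lambda) by diag (e_lambda (alpha_i)) gives every nonconstant
   term of an entry the length of some interval J_j as frequency.  Hence
   det (1 - B') is an exponential sum with constant term 1 and otherwise positive
   frequencies.  Pairing its derivatives at a point with a polynomial that kills
   all frequencies but 0 shows that they cannot all vanish, so that its zeros have
   finite order; comparing with the orders of the entries of the adjugate, the
   inverse of 1 - B' has a pole at each of them.

   For lambda in Lambda_p, a solution with A_0 = 0 has A_n = 0 as well because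
   B_(alpha, beta) is unitary, so that psi_lambda is supported on the bounded
   intervals and is an L^2 eigenfunction. *)

(** * Relations stable under ring operations, carried over to determinants and adjugates *)

Section RingRelations.
Variables (K : comNzRingType) (T : Type) (P : (T -> K) -> K -> Prop).

(** [P f a] attaches a value [a] to a function [f]. Three instances are used: convergence to [a],
    being an exponential sum (with [a] a dummy), and having constant term [a]. Determinants,
    adjugates and matrix products are thus treated once for all of them. *)
Definition ring_rel : Prop :=
  [/\ forall a, P (fun=> a) a,
      forall f g a b, P f a -> P g b -> P (fun x => f x + g x) (a + b) &
      forall f g a b, P f a -> P g b -> P (fun x => f x * g x) (a * b)].

Hypothesis relP : ring_rel.

Lemma ring_rel_sum (I : Type) (r : seq I) (f : I -> T -> K) (a : I -> K) :
  (forall i, P (f i) (a i)) -> P (fun x => \sum_(i <- r) f i x) (\sum_(i <- r) a i).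
Proof.
case: relP => Pcst PD _ fa; elim: r => [|i r IHr].
  by rewrite big_nil; under eq_fun do rewrite big_nil.
by rewrite big_cons; under eq_fun do rewrite big_cons; exact: PD.
Qed.

Lemma ring_rel_prod (I : Type) (r : seq I) (f : I -> T -> K) (a : I -> K) :
  (forall i, P (f i) (a i)) -> P (fun x => \prod_(i <- r) f i x) (\prod_(i <- r) a i).
Proof.
case: relP => Pcst _ PM fa; elim: r => [|i r IHr].
  by rewrite big_nil; under eq_fun do rewrite big_nil.
by rewrite big_cons; under eq_fun do rewrite big_cons; exact: PM.
Qed.

(** Leibniz expansion: a sum of products of entries, the signs being constants. *)
Lemma ring_rel_det n (M : T -> 'M[K]_n) (A : 'M[K]_n) :
    (forall i j, P (fun x => M x i j) (A i j)) ->
  P (fun x => \det (M x)) (\det A).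
Proof.
case: relP => Pcst _ PM MA; apply: ring_rel_sum => s.
by apply: PM => //; apply: ring_rel_prod.
Qed.

Lemma ring_rel_adj n (M : T -> 'M[K]_n) (A : 'M[K]_n) :
    (forall i j, P (fun x => M x i j) (A i j)) ->
  forall i j, P (fun x => (\adj (M x)) i j) ((\adj A) i j).
Proof.
case: relP => Pcst _ PM MA i j; rewrite mxE; under eq_fun do rewrite mxE.
apply: PM => //; apply: ring_rel_det => k l; rewrite !mxE.
by under eq_fun do rewrite !mxE.
Qed.

Lemma ring_rel_mulmx m n p (M : T -> 'M[K]_(m, n)) (N : T -> 'M[K]_(n, p))
    (A : 'M[K]_(m, n)) (B : 'M[K]_(n, p)) :
    (forall i j, P (fun x => M x i j) (A i j)) ->
    (forall i j, P (fun x => N x i j) (B i j)) ->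
  forall i j, P (fun x => (M x *m N x) i j) ((A *m B) i j).
Proof.
case: relP => _ _ PM MA NB i j; rewrite mxE; under eq_fun do rewrite mxE.
by apply: ring_rel_sum => k; exact: PM.
Qed.

End RingRelations.

(** * Exponential sums *)

Section ComplexLimits.
Variables (R : realType) (T : Type) (F : set_system T).
Context {FF : Filter F}.

Lemma cvg_real_complex (f : T -> R) (a : R) :
  f x @[x --> F] --> a -> ((f x)%:C : R[i]^o) @[x --> F] --> (a%:C : R[i]^o).
Proof.
move=> /cvgrPdist_lt fa; apply/cvgrPdist_lt => eps.
(* In the partial order of [R[i]], a positive [eps] has zero imaginary part, so the estimate is one
   between reals. *)
rewrite ltcE /= => /andP[/eqP eps_im eps_gt0].
near=> x; rewrite -rmorphB ltcE /= eps_im expr0n addr0 sqrtr_sqr eqxx /=.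
by near: x; exact: fa.
Unshelve. all: by end_near. Qed.

Lemma cvg_complex (f : T -> R[i]) (l : R[i]) :
    complex.Re (f x) @[x --> F] --> complex.Re l ->
    complex.Im (f x) @[x --> F] --> complex.Im l ->
  (f x : R[i]^o) @[x --> F] --> (l : R[i]^o).
Proof.
move=> fr fi; rewrite (complexE l).
rewrite (_ : f = fun x => (complex.Re (f x))%:C + 'i%C * (complex.Im (f x))%:C).
  2: by apply/funext => x; exact: complexE.
apply: cvgD; first exact: cvg_real_complex.
by apply: cvgM; [exact: cvg_cst | exact: cvg_real_complex].
Qed.

Lemma near_cvgC (f g : T -> R[i]) (l : R[i]) :
    (\forall x \near F, f x = g x) ->
    (f x : R[i]^o) @[x --> F] --> (l : R[i]^o) ->
  (g x : R[i]^o) @[x --> F] --> (l : R[i]^o).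
Proof. by move=> fg; apply: cvg_trans; exact: near_eq_cvg. Qed.

Lemma ring_rel_cvg :
  @ring_rel R[i] T (fun f a => (f x : R[i]^o) @[x --> F] --> (a : R[i]^o)).
Proof. by split=> [a|f g a b|f g a b]; [exact: cvg_cst | exact: cvgD | exact: cvgM]. Qed.

End ComplexLimits.

Lemma cvgC_unique (R : realType) (T : Type) (F : set_system T)
    (FF : ProperFilter F) (f : T -> R[i]) (a b : R[i]) :
    (f x : R[i]^o) @[x --> F] --> (a : R[i]^o) ->
    (f x : R[i]^o) @[x --> F] --> (b : R[i]^o) ->
  a = b.
Proof.
by apply: (@cvg_unique (R[i]^o)); exact: (@norm_hausdorff _ (R[i]^o)).
Qed.

Section ExponentialSums.
Variable R : realType.
Implicit Types (s t : seq (R[i] * R)) (mu : R).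

(** Reduces facts on imaginary parts to facts on real parts, with all coefficients multiplied by
    -i. *)
Lemma Im_Re (z : R[i]) : complex.Im z = complex.Re (- 'i%C * z).
Proof. by case: z => x y /=; ring. Qed.

(** Transfers results on exponential sums in the variable [mu] to e_lambda as a function of [x]. *)
Lemma e_sym lambda (x : R) : e lambda x = e x lambda.
Proof. by rewrite /e mulrAC. Qed.

Lemma e0 lambda : e lambda 0 = 1 :> R[i].
Proof. by rewrite /e mulr0 cos0 sin0. Qed.

Lemma eD lambda (x y : R) : e lambda (x + y) = e lambda x * e lambda y.
Proof.
rewrite /e mulrDr cosD sinD.
by apply/eqP; rewrite eq_complex /= eqxx /= [X in _ == X]addrC eqxx.
Qed.

Lemma e_neq0 lambda (x : R) : e lambda x != 0.
Proof.
apply/eqP => ex0; have /eqP := e0 lambda.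
by rewrite -(subrr x) eD ex0 mul0r eq_sym oner_eq0.
Qed.

Lemma eN lambda (x : R) : e lambda (- x) = (e lambda x)^-1.
Proof.
by apply: (mulfI (e_neq0 lambda x)); rewrite -eD subrr e0 divff // e_neq0.
Qed.

Lemma conj_e lambda (x : R) : (e lambda x)^* = e lambda (- x).
Proof. by rewrite /e /= mulrN cosN sinN. Qed.

(** The pairs are (coefficient, frequency). A frequency may be repeated, so that sums and products
    become plain list operations. *)
Definition expsum s mu : R[i] := \sum_(p <- s) p.1 * e mu p.2.

(** The list of the derivative in [mu]: a term of frequency w is multiplied by 2 pi i w. *)
Definition dexp s : seq (R[i] * R) :=
  [seq (p.1 * ('i%C * (2 * pi * p.2)%:C), p.2) | p <- s].

Lemma is_derive_Re_expsum s mu :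
  is_derive mu (1 : R) (fun y => complex.Re (expsum s y))
    (complex.Re (expsum (dexp s) mu)).
Proof.
rewrite /expsum; elim: s => [|[c w] s IHs].
  rewrite !big_nil /=; under eq_fun do rewrite big_nil.
  exact: is_derive_cst.
rewrite /= !big_cons /= raddfD /=; under eq_fun do rewrite big_cons raddfD /=.
apply: is_deriveD; move: c => [a b]; rewrite e_sym /=.
pose k := 2 * pi * w.
have dk : is_derive mu (1 : R) ( *%R k) k.
  by apply: is_derive_eq; rewrite /GRing.scale /= mulr1.
have dcos := is_derive1_comp (is_derive_cos (k * mu)) dk.
have dsin := is_derive1_comp (is_derive_sin (k * mu)) dk.
(* The real part of (a + ib) e^(i t) is a cos t - b sin t. *)
have dE := is_deriveB (is_deriveZ a dcos) (is_deriveZ b dsin).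
rewrite (_ : (fun x => _) = a *: (cos \o *%R k) - b *: (sin \o *%R k)).
  2: by apply/funext => x; rewrite /k [RHS]/(_ - _) /= /GRing.scale /= [2 * pi * x * w]mulrAC.
by apply: is_derive_eq; rewrite /GRing.scale /= /k; ring.
Qed.

Definition scale_exp (a : R[i]) s : seq (R[i] * R) := [seq (a * p.1, p.2) | p <- s].

Lemma expsum_scale a s mu : expsum (scale_exp a s) mu = a * expsum s mu.
Proof. by rewrite /expsum big_map mulr_sumr; apply: eq_bigr => p _; rewrite mulrA. Qed.

Lemma iter_dexpE k s :
  iter k dexp s = [seq (p.1 * ('i%C * (2 * pi * p.2)%:C) ^+ k, p.2) | p <- s].
Proof.
elim: k => [|k IHk] /=; first by rewrite -[LHS]map_id; apply: eq_map => -[a w]; rewrite mulr1.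
rewrite IHk /dexp -map_comp; apply: eq_map => p /=. rewrite exprSr; congr pair; ring.
Qed.

Lemma dexp_scale a k s : iter k dexp (scale_exp a s) = scale_exp a (iter k dexp s).
Proof.
by rewrite !iter_dexpE /scale_exp -!map_comp; apply: eq_map => p /=; rewrite mulrA.
Qed.

Lemma cvg_Re_expsum s mu :
  complex.Re (expsum s y) @[y --> mu] --> complex.Re (expsum s mu).
Proof.
have d := is_derive_Re_expsum s mu.
by apply: differentiable_continuous; apply/derivable1_diffP; exact: ex_derive.
Qed.

Lemma is_derive_sub_exp k (y mu : R) :
  is_derive y (1 : R) (fun z => (z - mu) ^+ k.+1) (k.+1%:R * (y - mu) ^+ k).
Proof.
have d1 : is_derive y (1 : R) (fun z => z - mu) 1.
  by apply: is_derive_eq; rewrite subr0.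
have dE := is_deriveX k.+1 d1; rewrite exprfctE in dE.
by apply: is_derive_eq; rewrite /GRing.scale /= mulr1.
Qed.

Lemma cvg_sub_exp k mu : (y - mu) ^+ k.+1 @[y --> mu] --> (0 : R).
Proof.
rewrite -[X in _ --> X](_ : (mu - mu) ^+ k.+1 = 0); last by rewrite subrr expr0n.
have d := is_derive_sub_exp k mu mu.
apply: (differentiable_continuous (f := fun y => (y - mu) ^+ k.+1)).
by apply/derivable1_diffP; exact: ex_derive.
Qed.

(** Leading Taylor coefficient, by induction on [k]: l'Hopital's rule on each side of [mu] passes
    from [s] and (y - mu)^(k+1) to [dexp s] and (k+1)(y - mu)^k. *)
Lemma Re_expsum_order k s mu :
    (forall i, (i < k)%N -> complex.Re (expsum (iter i dexp s) mu) = 0) ->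
  complex.Re (expsum s y) / (y - mu) ^+ k @[y --> mu^'] -->
    complex.Re (expsum (iter k dexp s) mu) / k`!%:R.
Proof.
elim: k s => [|k IHk] s s0.
  rewrite /= fact0 divr1; under eq_fun do rewrite expr0 divr1.
  by apply: cvg_within_filter; exact: cvg_Re_expsum.
have {}IHk : complex.Re (expsum (dexp s) y) / (y - mu) ^+ k @[y --> mu^'] -->
    complex.Re (expsum (iter k.+1 dexp s) mu) / k`!%:R.
  by rewrite iterSr; apply: IHk => i ik; rewrite -iterSr s0.
have ds y : is_derive y (1 : R) (fun z => complex.Re (expsum s z)) (complex.Re (expsum (dexp s) y)).
  exact: is_derive_Re_expsum.
have dg y := is_derive_sub_exp k y mu.
have f_mu : complex.Re (expsum s y) @[y --> mu] --> (0 : R).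
  by rewrite -(s0 0%N isT); exact: cvg_Re_expsum.
have g_mu := cvg_sub_exp k mu.
have dg_neq0 y : y != mu -> k.+1%:R * (y - mu) ^+ k != 0.
  by move=> ymu; rewrite mulf_neq0 ?pnatr_eq0 // expf_neq0 // subr_eq0.
have dfdg : complex.Re (expsum (dexp s) y) / (k.+1%:R * (y - mu) ^+ k) @[y --> mu^']
    --> complex.Re (expsum (iter k.+1 dexp s) mu) / k.+1`!%:R.
  rewrite factS natrM invfM [_^-1 / _]mulrC mulrA.
  under eq_fun do rewrite invfM [_^-1 / _]mulrC mulrA.
  by apply: cvgM => //; exact: cvg_cst.
apply: (@cvg_at_right_left_dnbhs _ R^o).
- apply: (@lhopital_at_right _ _ _ _ _ mu (mu + 1) _ _ (fun x _ => ds x) (fun x _ => dg x)).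
  + by rewrite ltrDl.
  + exact: cvg_at_right_filter.
  + exact: cvg_at_right_filter.
  + by move=> x; rewrite in_itv /= => /andP[mux _]; rewrite dg_neq0 // gt_eqF.
  + exact: cvg_dnbhs_at_right.
- apply: (@lhopital_at_left _ _ _ _ _ (mu - 1) mu _ _ (fun x _ => ds x) (fun x _ => dg x)).
  + by rewrite ltrBlDr ltrDl.
  + exact: cvg_at_left_filter.
  + exact: cvg_at_left_filter.
  + by move=> x; rewrite in_itv /= => /andP[_ mux]; rewrite dg_neq0 // lt_eqF.
  + exact: cvg_dnbhs_at_left.
Qed.

(** The divisors are real, so real and imaginary parts separate; the latter is the real part of the
    sum scaled by -i, and scaling commutes with [dexp]. *)
Lemma expsum_order k s mu :
    (forall i, (i < k)%N -> expsum (iter i dexp s) mu = 0) ->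
  (expsum s y / (y - mu)%:C ^+ k : R[i]^o) @[y --> mu^'] -->
    (expsum (iter k dexp s) mu / k`!%:R : R[i]^o).
Proof.
move=> s0.
have ReM (z : R[i]) (a : R) : complex.Re (z / a%:C) = complex.Re z / a.
  by rewrite -fmorphV; case: z => x y /=; rewrite mulr0 subr0.
have ImM (z : R[i]) (a : R) : complex.Im (z / a%:C) = complex.Re (- 'i%C * z) / a.
  by rewrite -fmorphV; case: z => x y /=; ring.
have fE : k`!%:R = (k`!%:R : R)%:C by rewrite rmorph_nat.
apply: cvg_complex.
  under eq_fun do rewrite -rmorphXn ReM.
  rewrite fE ReM; apply: Re_expsum_order => i ik.
  by rewrite s0.
under eq_fun do rewrite -rmorphXn ImM -expsum_scale.
rewrite fE ImM -expsum_scale -dexp_scale; apply: Re_expsum_order => i ik.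
by rewrite dexp_scale expsum_scale s0 // mulr0.
Qed.

(** Combining the derivatives with the coefficients of a polynomial q multiplies each term of
    frequency v by q(2 pi i v). A q that vanishes at all frequencies of [s] except w isolates the
    total coefficient of w. *)
Lemma expsum_coeff0 s mu :
    (forall k, expsum (iter k dexp s) mu = 0) ->
  forall w, \sum_(p <- s | p.2 == w) p.1 = 0.
Proof.
move=> s0 w; pose a (v : R) : R[i] := 'i%C * (2 * pi * v)%:C.
have s0q (q : {poly R[i]}) : \sum_(p <- s) p.1 * e mu p.2 * q.[a p.2] = 0.
  transitivity (\sum_(i < size q) q`_i * expsum (iter i dexp s) mu).
    under [RHS]eq_bigr do rewrite iter_dexpE /expsum big_map mulr_sumr.
    rewrite exchange_big /=; apply: eq_bigr => p _.
    rewrite horner_coef mulr_sumr; apply: eq_bigr => i _; rewrite /a; ring.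
  by rewrite big1 // => i _; rewrite s0 mulr0.
pose q := \prod_(v <- [seq p.2 | p <- s] | v != w) ('X - (a v)%:P).
(* Distinct frequencies give distinct nodes, so that [q] does not vanish at [a w]. *)
have aI : injective a.
  have i_neq0 : 'i%C != 0 :> R[i] by rewrite eq_complex /= oner_eq0 andbF.
  move=> v v' /(mulfI i_neq0) /complexI; apply: mulfI.
  by rewrite mulf_neq0 ?pnatr_eq0 // gt_eqF // pi_gt0.
have qw : q.[a w] != 0.
  rewrite /q horner_prod prodf_seq_neq0; apply/allP => v _; apply/implyP => vw.
  by rewrite hornerXsubC subr_eq0 (inj_eq aI) eq_sym.
have := s0q q; rewrite (bigID (fun p => p.2 == w)) /= [X in _ + X]big1_seq => [|[c v]].
  rewrite addr0 => h.
  apply: (mulIf (e_neq0 mu w)); apply: (mulIf qw); rewrite !mul0r -[RHS]h !mulr_suml.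
  by apply: eq_bigr => p /eqP ->.
move=> /andP[/= vw vs]; suff -> : q.[a v] = 0 by rewrite mulr0.
apply/eqP; rewrite /q horner_prod prodf_seq_eq0; apply/hasP; exists v.
  by apply/mapP; exists (c, v).
by rewrite vw hornerXsubC subrr eqxx.
Qed.

(** Frequency 0 occurs only in the head, with coefficient 1, so some derivative at [mu] is nonzero;
    [k] is the least such order. *)
Lemma expsum_order_exists s mu : all (fun p => 0 < p.2) s ->
  exists2 k, expsum (iter k dexp ((1, 0) :: s)) mu != 0 &
    forall i, (i < k)%N -> expsum (iter i dexp ((1, 0) :: s)) mu = 0.
Proof.
move=> s_gt0; set t := _ :: s.
have ex : exists k, expsum (iter k dexp t) mu != 0.
  apply: contrapT => /forallNP t0.
  have {}t0 k : expsum (iter k dexp t) mu = 0 by apply/eqP/negPn/negP/t0.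
  have /eqP := expsum_coeff0 t0 0; rewrite big_cons eqxx /= big1_seq.
    by rewrite addr0 oner_eq0.
  by move=> p /andP[/eqP p0 /(allP s_gt0)]; rewrite p0 ltxx.
exists (ex_minn ex); case: ex_minnP => // k _ kmin i.
by apply: contraTeq => /kmin; rewrite leqNgt.
Qed.

Definition is_expsum (f : R -> R[i]) : Prop := exists s, f = expsum s.

(** Positivity of the other frequencies makes the constant term multiplicative: no product of
    nonconstant terms falls back to frequency 0. *)
Definition has_constant_term (f : R -> R[i]) (a : R[i]) : Prop :=
  exists2 s, all (fun p => 0 < p.2) s & f = expsum ((a, 0) :: s).

Definition mul_exp s t : seq (R[i] * R) :=
  [seq (p.1 * q.1, p.2 + q.2) | p <- s, q <- t].

Lemma expsum_cat s t mu : expsum (s ++ t) mu = expsum s mu + expsum t mu.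
Proof. exact: big_cat. Qed.

Lemma expsum_mul s t mu : expsum (mul_exp s t) mu = expsum s mu * expsum t mu.
Proof.
rewrite /expsum /mul_exp big_allpairs_dep big_distrl; apply: eq_bigr => p _.
rewrite big_distrr; apply: eq_bigr => q _ /=; rewrite eD; ring.
Qed.

Lemma expsum_cons a w s mu : expsum ((a, w) :: s) mu = a * e mu w + expsum s mu.
Proof. by rewrite /expsum big_cons. Qed.

Lemma expsum_nil mu : expsum [::] mu = 0.
Proof. by rewrite /expsum big_nil. Qed.

Lemma is_expsum_monom a (w : R) : is_expsum (fun mu => a * e mu w).
Proof.
by exists [:: (a, w)]; apply/funext => mu; rewrite expsum_cons expsum_nil addr0.
Qed.

Lemma ring_rel_expsum : ring_rel (fun f (_ : R[i]) => is_expsum f).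
Proof.
split=> [a|_ _ _ _ [s ->] [t ->]|_ _ _ _ [s ->] [t ->]].
- have [s sE] := is_expsum_monom a 0; exists s; rewrite -sE.
  by apply/funext => mu; rewrite e0 mulr1.
- by exists (s ++ t); apply/funext => mu; rewrite expsum_cat.
- by exists (mul_exp s t); apply/funext => mu; rewrite expsum_mul.
Qed.

Lemma ring_rel_constant_term : ring_rel has_constant_term.
Proof.
split=> [a|_ _ a b [s s0 ->] [t t0 ->]|_ _ a b [s s0 ->] [t t0 ->]].
- by exists [::] => //; apply/funext => mu; rewrite expsum_cons expsum_nil e0 mulr1 addr0.
- exists (s ++ t); first by rewrite all_cat s0.
  by apply/funext => mu; rewrite !expsum_cons expsum_cat; ring.
(* (a + s)(b + t) = ab + at + bs + st, and the last three have positive frequencies. *)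
exists (scale_exp a t ++ scale_exp b s ++ mul_exp s t).
  rewrite !all_cat !all_map s0 t0 /=.
  apply/allP => _ /allpairsP[[p q] /= [ps qt ->]] /=.
  by rewrite addr_gt0 // ?(allP s0 p) ?(allP t0 q).
apply/funext => mu.
by rewrite !expsum_cons !expsum_cat expsum_mul !expsum_scale e0; ring.
Qed.

Lemma has_constant_term_monom a (w : R) :
  0 < w -> has_constant_term (fun mu => a * e mu w) 0.
Proof.
move=> w0; exists [:: (a, w)]; rewrite /= ?w0 //.
by apply/funext => mu; rewrite !expsum_cons expsum_nil mul0r add0r addr0.
Qed.

Lemma is_expsum_cvg (f : R -> R[i]) mu : is_expsum f ->
  (f y : R[i]^o) @[y --> mu] --> (f mu : R[i]^o).
Proof.
move=> [s ->]; apply: cvg_complex; first exact: cvg_Re_expsum.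
rewrite Im_Re -expsum_scale; under eq_fun do rewrite Im_Re -expsum_scale.
exact: cvg_Re_expsum.
Qed.

(* The smallest order of vanishing at [mu] of an entry of [adj (M mu)] cannot
   reach that of [det (M mu)], as otherwise [M^-1] would have a limit at [mu]. *)
Lemma invmx_pole n (M : R -> 'M[R[i]]_n) mu :
    (forall i j, is_expsum (fun y => M y i j)) ->
    has_constant_term (fun y => \det (M y)) 1 ->
    \det (M mu) = 0 ->
  exists i j, real_pole (fun y => invmx (M y) i j) mu.
Proof.
move=> Mexp [d d_gt0 dE] detM0.
have [k dk_neq0 dk0] := expsum_order_exists mu d_gt0.
have k_gt0 : (0 < k)%N.
  by rewrite lt0n; apply/eqP => k0; move: dk_neq0; rewrite k0 /= -dE /= detM0 eqxx.
have detk := expsum_order dk0; rewrite -dE in detk.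
set dl := _ / k`!%:R in detk.
have dl_neq0 : dl != 0.
  by rewrite mulf_neq0 // invr_neq0 // pnatr_eq0 -lt0n fact_gt0.
have t_neq0 j : \forall y \near mu^', (y - mu)%:C ^+ j != 0 :> R[i].
  near=> y; rewrite expf_neq0 // -(rmorph0 (real_complex R)) (inj_eq (@complexI R)).
  by rewrite subr_eq0; near: y; exact: nbhs_dnbhs_neq.
have M_unit : \forall y \near mu^', M y \in unitmx.
  near=> y.
  have : \det (M y) / (y - mu)%:C ^+ k != 0.
    by near: y; exact: (@cvgr_neq0 _ (R[i]^o) _ _ _ _ _ detk).
  by rewrite unitmxE unitfE; apply: contraNN => /eqP ->; rewrite mul0r.
(* [M mu] below only fills the dummy value of the relation. *)
have adj_exp ij : exists s, (fun y => (\adj (M y)) ij.1 ij.2) = expsum s.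
  exact: (ring_rel_adj ring_rel_expsum (A := M mu)).
have [a aE] := boolp.choice adj_exp.
have {adj_exp}aE i j : (fun y => (\adj (M y)) i j) = expsum (a (i, j)).
  by rewrite -(aE (i, j)).
(* Either some entry of the adjugate vanishes at [mu] to an order below the order [k] of the
   determinant, or none does. *)
have [[[i j] [l' l'k al']]|high] :=
    pselect (exists ij, exists2 l, (l < k)%N & expsum (iter l dexp (a ij)) mu != 0).
  have ex : exists l, expsum (iter l dexp (a (i, j))) mu != 0 by exists l'.
  move: (ex_minnP ex) => [l al_neq0 lmin].
  have lk : (l < k)%N := leq_ltn_trans (lmin _ al') l'k.
  have al0 l1 : (l1 < l)%N -> expsum (iter l1 dexp (a (i, j))) mu = 0.
    by move=> l1l; apply/eqP; apply: contraTT l1l => /lmin; rewrite leqNgt.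
  have adjl := expsum_order al0; rewrite -aE in adjl.
  set al := _ / l`!%:R in adjl.
  (* The entry of adj / det has a pole of order k - l, and [real_pole] counts the order as a
     successor. *)
  exists i, j, (k - l.+1)%N, (al / dl); split.
    by rewrite !mulf_neq0 ?invr_neq0 // pnatr_eq0 -lt0n fact_gt0.
  have lim : ((\adj (M y)) i j / (y - mu)%:C ^+ l / (\det (M y) / (y - mu)%:C ^+ k)
      : R[i]^o) @[y --> mu^'] --> (al / dl : R[i]^o).
    by apply: cvgM adjl _; exact: cvgV.
  apply: near_cvgC lim; near=> y.
  have Mu : M y \in unitmx by near: y.
  have tl : (y - mu)%:C ^+ l != 0 :> R[i] by near: y; exact: t_neq0.
  have tk : (y - mu)%:C ^+ (k - l) != 0 :> R[i] by near: y; exact: t_neq0.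
  rewrite /invmx Mu [X in _ = _ * X]mxE subnSK //.
  have tkE : (y - mu)%:C ^+ k = (y - mu)%:C ^+ (k - l) * (y - mu)%:C ^+ l :> R[i].
    by rewrite -exprD subnK // ltnW.
  rewrite tkE.
  have det_neq0 : \det (M y) != 0 by rewrite -unitfE -unitmxE.
  move: (_ ^+ l) tl (_ ^+ (k - l)) tk (\det _) det_neq0 => x x0 z z0 v v0.
  by field; rewrite x0 z0 v0.
exfalso.
(* [A] is the limit of adj (M y) / (y - mu)^k. Dividing M adj M = det M by (y - mu)^k gives
   [M mu *m A = dl%:M] in the limit, which is invertible although [M mu] is singular. *)
pose A := \matrix_(i, j) (expsum (iter k dexp (a (i, j))) mu / k`!%:R) : 'M[R[i]]_n.
have adjk i j : ((((y - mu)%:C ^+ k)^-1 *: \adj (M y)) i j : R[i]^o) @[y --> mu^']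
    --> (A i j : R[i]^o).
  rewrite mxE; under eq_fun do rewrite mxE mulrC.
  have a0 l : (l < k)%N -> expsum (iter l dexp (a (i, j))) mu = 0.
    by move=> lk; apply/eqP; apply: contra_notT high => al; exists (i, j); exists l.
  by have := expsum_order a0; rewrite -aE.
have Mcvg i j : (M y i j : R[i]^o) @[y --> mu^'] --> (M mu i j : R[i]^o).
  by apply: cvg_within_filter; apply: (@is_expsum_cvg (fun y => M y i j)).
have MA : M mu *m A = dl%:M.
  apply/matrixP => i j.
  have lim : ((M y *m (((y - mu)%:C ^+ k)^-1 *: \adj (M y))) i j : R[i]^o)
      @[y --> mu^'] --> ((M mu *m A) i j : R[i]^o).
    exact: (ring_rel_mulmx (@ring_rel_cvg R R mu^' _) Mcvg adjk i j).
  apply: cvgC_unique lim _.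
  under eq_fun do rewrite -scalemxAr mul_mx_adj mxE mxE mulrnAr [_^-1 * _]mulrC.
  rewrite mxE; case: (i == j); [exact: detk | exact: (@cvg_cst R[i]^o)].
have /eqP := congr1 determinant MA; rewrite det_mulmx detM0 mul0r det_scalar.
by rewrite eq_sym expf_eq0 (negPf dl_neq0) andbF.
Unshelve. all: by end_near. Qed.

End ExponentialSums.

(** * Block elimination *)

Section Stack.
Local Open Scope sesquilinear_scope.
Variables (R : realType) (m : nat).
Implicit Types (C : 'M[R[i]]_m.+1) (A : 'cV[R[i]]_m.+2) (v : 'cV[R[i]]_m) (x y : R[i]).

Lemma row'E n p i (D : 'M[R[i]]_(n.+1, p)) (j : 'I_n) k :
  (row' i D : 'M[R[i]]_(n, p)) j k = D (lift i j) k.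
Proof. exact: mxE. Qed.

Lemma stack_first x v y : stack x v y ord0 0 = x.
Proof. by rewrite mxE unlift_none. Qed.

Lemma stack_mid x v y i : stack x v y (lift ord0 (lift ord_max i)) 0 = v i 0.
Proof. by rewrite mxE !liftK. Qed.

Lemma stack_last x v y : stack x v y (lift ord0 ord_max) 0 = y.
Proof. by rewrite mxE liftK unlift_none. Qed.

Lemma lift_max0 n : lift ord_max ord0 = ord0 :> 'I_n.+2.
Proof. exact: val_inj. Qed.

Lemma lift0_max n : lift ord0 ord_max = ord_max :> 'I_n.+2.
Proof. exact: val_inj. Qed.

Lemma lift_max_lift0 n (j : 'I_n) :
  lift ord_max (lift ord0 j) = lift ord0 (lift ord_max j).
Proof. by apply: val_inj; rewrite /= /bump /= !add1n ltnS leqNgt ltn_ord. Qed.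

Lemma stack_surj A :
  A = stack (A ord0 0) (\col_i A (lift ord0 (lift ord_max i)) 0) (A ord_max 0).
Proof.
apply/colP => k; case: (unliftP ord0 k) => [k'|] ->; last by rewrite stack_first.
case: (unliftP ord_max k') => [i|] ->; first by rewrite stack_mid mxE.
by rewrite stack_last lift0_max.
Qed.

Lemma scale_stack a x v y : a *: stack x v y = stack (a * x) (a *: v) (a * y).
Proof.
apply/colP => k; rewrite !mxE; case: (unlift _ _) => // k'.
by case: (unlift _ _) => // i; rewrite mxE.
Qed.

Lemma add_stack x v y x' v' y' :
  stack x v y + stack x' v' y' = stack (x + x') (v + v') (y + y').
Proof.
apply/colP => k; rewrite !mxE; case: (unlift _ _) => // k'.
by case: (unlift _ _) => // i; rewrite mxE.
Qed.

Lemma inner_wblock C v :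
  inner (wblock C) v = \sum_j C ord_max (lift ord0 j) * v j 0.
Proof.
by rewrite /inner mxE; apply: eq_bigr => j _; rewrite !mxE conjCK.
Qed.

(** Row by row: the upper rows read u x + C' v = v, the last one c x + w^* v = y. *)
Lemma stack_solution C x v y :
  C *m row' ord_max (stack x v y) = row' ord0 (stack x v y) <->
  (1%:M - corner C) *m v = x *: ublock C /\ y = cblock C * x + inner (wblock C) v.
Proof.
have CE i : (C *m row' ord_max (stack x v y)) i 0
    = C i ord0 * x + \sum_j C i (lift ord0 j) * v j 0.
  rewrite mxE big_ord_recl row'E lift_max0 stack_first; congr (_ + _).
  apply: eq_bigr => j _. by rewrite row'E lift_max_lift0 stack_mid.
have cE i : (corner C *m v) i 0 = \sum_j C (lift ord_max i) (lift ord0 j) * v j 0.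
  by rewrite mxE; apply: eq_bigr => j _; rewrite !mxE.
split=> [sol|[vE yE]].
- split.
  + apply/colP => i; have := congr1 (fun A : 'cV[R[i]]_m.+1 => A (lift ord_max i) 0) sol.
    rewrite /= CE row'E stack_mid mulmxBl mul1mx => vi.
    have subE : (v - corner C *m v) i 0 = v i 0 - (corner C *m v) i 0 by rewrite !mxE.
    by rewrite subE cE -vi !mxE; ring.
  + have := congr1 (fun A : 'cV[R[i]]_m.+1 => A ord_max 0) sol.
    by rewrite /= CE row'E stack_last inner_wblock.
apply/colP => i; rewrite CE row'E.
case: (unliftP ord_max i) => [j|] ->.
  rewrite stack_mid; have := congr1 (fun A : 'cV[R[i]]_m => A j 0) vE.
  have subE : (v - corner C *m v) j 0 = v j 0 - (corner C *m v) j 0 by rewrite !mxE.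
  rewrite mulmxBl mul1mx subE cE => /eqP; rewrite !mxE.
  by rewrite subr_eq => /eqP ->; rewrite mulrC.
by rewrite stack_last yE inner_wblock.
Qed.

Lemma cornerE C i j : corner C i j = C (lift ord_max i) (lift ord0 j).
Proof. by rewrite /corner row'E mxE. Qed.

Lemma one_sub_cornerE C i j :
  (1%:M - corner C) i j = (i == j)%:R - C (lift ord_max i) (lift ord0 j).
Proof. by rewrite [LHS]mxE mxE [X in _ + X]mxE cornerE. Qed.

(** [eigenvalue] is defined by a nonzero kernel of [corner C - 1%:M]; for a square matrix this is
    singularity, unaffected by the sign. *)
Lemma eigenvalue_corner C : eigenvalue (corner C) 1 = (\det (1%:M - corner C) == 0).
Proof.
rewrite /eigenvalue /eigenspace kermx_eq0 row_free_unit -opprB.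
by rewrite -scaleN1r unitmxZ ?unitrN1 // unitmxE unitfE negbK.
Qed.

Lemma inner_scale w a v : inner w (a *: v) = a * inner w v.
Proof. by rewrite /inner -scalemxAr mxE. Qed.

Lemma inner_add w v v' : inner w (v + v') = inner w v + inner w v'.
Proof. by rewrite /inner mulmxDr mxE. Qed.

Lemma solution_stackP C A :
  C *m row' ord_max A = row' ord0 A <->
  exists x v, (1%:M - corner C) *m v = x *: ublock C /\
    A = stack x v (cblock C * x + inner (wblock C) v).
Proof.
split=> [|[x [v [vE ->]]]]; last exact/stack_solution.
rewrite [A]stack_surj => /stack_solution[vE yE].
by exists (A ord0 0), (\col_i A (lift ord0 (lift ord_max i)) 0); rewrite vE -yE.
Qed.

Lemma regular_solution C A : 1%:M - corner C \in unitmx ->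
  C *m row' ord_max A = row' ord0 A <-> exists x0, A = resolvent_vector C x0.
Proof.
move=> Cu; set v := invmx (1%:M - corner C) *m ublock C.
have resE x : resolvent_vector C x = stack x (x *: v) (cblock C * x + inner (wblock C) (x *: v)).
  by rewrite /resolvent_vector -/v scale_stack mulr1 mulrDr inner_scale mulrC.
rewrite solution_stackP; split=> [[x [z [zE ->]]]|[x ->]]; exists x.
  by rewrite resE -[z](mulKmx Cu) zE -scalemxAr.
by exists (x *: v); rewrite resE -scalemxAr mulKVmx.
Qed.

Lemma resolvent_vectorE C a :
  let v := invmx (1%:M - corner C) *m ublock C in
  [/\ resolvent_vector C a ord0 0 = a,
      forall i, resolvent_vector C a (lift ord0 (lift ord_max i)) 0 = a * v i 0 &
      resolvent_vector C a (lift ord0 ord_max) 0 =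
        a * (C ord_max ord0 + \sum_j C ord_max (lift ord0 j) * v j 0)].
Proof.
move=> v; rewrite /resolvent_vector scale_stack mulr1 inner_wblock -/v.
by split=> [|i|]; rewrite ?stack_first ?stack_mid ?stack_last // mxE.
Qed.

(** A nonzero [x] would make [x^-1 *: v] a preimage of u; hence x = 0. *)
Lemma singular_solution_out C A :
    ~ (exists v, (1%:M - corner C) *m v = ublock C) ->
  C *m row' ord_max A = row' ord0 A <->
  exists2 v, (1%:M - corner C) *m v = 0 & A = stack 0 v (inner (wblock C) v).
Proof.
move=> nex; rewrite solution_stackP; split=> [[x [v [vE ->]]]|[v v0 ->]].
  have [x0|x_neq0] := eqVneq x 0.
    by exists v; rewrite ?x0 ?mulr0 ?add0r // vE x0 scale0r.
  by case: nex; exists (x^-1 *: v); rewrite -scalemxAr vE scalerA mulVf // scale1r.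
by exists 0, v; rewrite v0 scale0r mulr0 add0r.
Qed.

(** If (1 - C') v = x u, then v - x v0 lies in the kernel. *)
Lemma singular_solution_in C v0 A : (1%:M - corner C) *m v0 = ublock C ->
  C *m row' ord_max A = row' ord0 A <->
  exists x0 v, (1%:M - corner C) *m v = 0 /\
    A = x0 *: stack 1 v0 (cblock C + inner (wblock C) v0) + stack 0 v (inner (wblock C) v).
Proof.
have sumE x v : x *: stack 1 v0 (cblock C + inner (wblock C) v0) +
    stack 0 v (inner (wblock C) v) =
    stack x (x *: v0 + v) (cblock C * x + inner (wblock C) (x *: v0 + v)).
  rewrite scale_stack add_stack mulr1 addr0 inner_add inner_scale mulrDr addrA.
  by rewrite [x * cblock C]mulrC.
move=> v0E; rewrite solution_stackP; split=> [[x [v [vE ->]]]|[x [v [vE ->]]]]; exists x.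
  exists (v - x *: v0); rewrite sumE subrKC; split=> //.
  by rewrite mulmxBr vE -scalemxAr v0E subrr.
by exists (x *: v0 + v); rewrite sumE mulmxDr vE addr0 -scalemxAr v0E.
Qed.

(** [C] is an isometry, so (A_0, ..., A_(n-1)) and (A_1, ..., A_n) have equal norms; their common
    entries cancel. *)
Lemma unitary_solution C A : C \is unitarymx ->
  C *m row' ord_max A = row' ord0 A -> `|A ord0 0| = `|A ord_max 0|.
Proof.
move=> /unitarymxP CC sol.
have {}CC : C^t* *m C = 1%:M by exact: mulmx1C.
have sq n (v : 'cV[R[i]]_n) : (v^t* *m v) 0 0 = \sum_i `|v i 0| ^+ 2.
  by rewrite mxE; apply: eq_bigr => i _; rewrite !mxE mulrC -normCK.
have isom : ((row' ord0 A)^t* *m row' ord0 A) 0 0 = ((row' ord_max A)^t* *m row' ord_max A) 0 0.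
  rewrite -sol trmx_mul map_mxM /= -mulmxA [C^t* *m _]mulmxA CC mul1mx //.
have lo : \sum_k `|A k 0| ^+ 2 = `|A ord0 0| ^+ 2 + ((row' ord0 A)^t* *m row' ord0 A) 0 0.
  rewrite big_ord_recl sq; congr (_ + _); apply: eq_bigr => i _; by rewrite row'E.
have hi : \sum_k `|A k 0| ^+ 2 = `|A ord_max 0| ^+ 2 + ((row' ord_max A)^t* *m row' ord_max A) 0 0.
  rewrite big_ord_recr addrC sq; congr (_ + _); apply: eq_bigr => i _.
  rewrite row'E; congr (`|A _ 0| ^+ 2).
  by apply: val_inj; rewrite /= /bump leqNgt ltn_ord.
move: lo; rewrite hi isom => /addIr /esym /eqP.
by rewrite eqrXn2 // => /eqP.
Qed.

End Stack.

(** * The matrix B_(alpha, beta) and the poles of its resolvent *)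

Section Corner.
Local Open Scope sesquilinear_scope.
Variables (R : realType) (m : nat) (alpha beta : 'I_m.+1 -> R) (B : 'M[R[i]]_m.+1).
Implicit Types lambda mu : R.

Local Notation Bl := (Bab alpha beta B).
Local Notation M mu := (1%:M - corner (Bl mu)).

Lemma adj_D (t : 'I_m.+1 -> R) lambda : (D t lambda)^t* = D (fun i => - t i) lambda.
Proof.
rewrite /D tr_diag_mx map_diag_mx; congr diag_mx.
by apply/rowP => i; rewrite !mxE -conj_e.
Qed.

Lemma D_unitary (t : 'I_m.+1 -> R) lambda : D t lambda \is unitarymx.
Proof.
apply/unitarymxP; rewrite adj_D /D mulmx_diag.
by apply/matrixP => i j; rewrite !mxE -eD subrr e0.
Qed.

Lemma BabE lambda i j :
  Bl lambda i j = B i j * e lambda (beta j - alpha i).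
Proof.
rewrite /Bab adj_D /D mul_mx_diag mul_diag_mx !mxE eD; ring.
Qed.

Lemma Bab_unitary lambda : B \is unitarymx -> Bl lambda \is unitarymx.
Proof.
by move=> hB; rewrite /Bab !mul_unitarymx ?trmxC_unitary ?D_unitary.
Qed.

Lemma Bab_is_expsum i j : is_expsum (fun mu => Bl mu i j).
Proof. by under eq_fun do rewrite BabE; exact: is_expsum_monom. Qed.

Lemma one_sub_corner_is_expsum i j : is_expsum (fun mu => M mu i j).
Proof.
have [Pcst PD _] := @ring_rel_expsum R.
under eq_fun do rewrite one_sub_cornerE BabE -mulNr.
by apply: (PD _ _ 0 0); [exact: (Pcst (i == j)%:R) | exact: is_expsum_monom].
Qed.

(* Conjugating [1 - B'] by [diag (e mu (alpha i))] turns the frequency of its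
   entry [(i, j)] into [beta_(j+1) - alpha_j > 0], the length of [J_j]. *)
Lemma det_constant_term :
    interlaced alpha beta -> has_constant_term (fun mu => \det (M mu)) 1.
Proof.
move=> [_ ab].
pose D' mu : 'M[R[i]]_m := diag_mx (\row_i e mu (alpha (lift ord_max i))).
pose G mu : 'M[R[i]]_m := \matrix_(i, j) (B (lift ord_max i) (lift ord0 j) *
  e mu (beta (lift ord0 j) - alpha (lift ord_max j))).
have conjE mu : D' mu *m M mu = (1%:M - G mu) *m D' mu.
  rewrite mulmxBl mulmxBr mulmx1 mul1mx; congr (_ - _).
  apply/matrixP => i j; rewrite mul_diag_mx mul_mx_diag mxE [RHS]mxE cornerE BabE !mxE.
  by rewrite !eD !eN; field; rewrite !e_neq0.
have detE : (fun mu => \det (M mu)) = fun mu => \det (1%:M - G mu).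
  apply/funext => mu; have := congr1 determinant (conjE mu).
  rewrite !det_mulmx mulrC; apply: mulIf; rewrite det_diag.
  by rewrite prodf_seq_neq0; apply/allP => i _; rewrite mxE e_neq0.
(* The entries of [1%:M - G mu] have those of the identity matrix as constant terms, so the
   determinant has constant term det 1 = 1. *)
rewrite detE -[X in has_constant_term _ X](det1 _ m).
apply: (ring_rel_det (@ring_rel_constant_term R)) => i j.
have [Pcst PD _] := @ring_rel_constant_term R.
under eq_fun do rewrite !mxE -mulNr.
rewrite -[X in has_constant_term _ X]addr0; apply: PD.
  by rewrite mxE; exact: Pcst.
apply: has_constant_term_monom; rewrite subr_gt0; apply: ab.
(* [lift ord_max j] has value j and [lift ord0 j] has value j + 1: the two indices are
   consecutive. *)
by rewrite /= /bump [(m <= j)%N]leqNgt ltn_ord.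
Qed.

End Corner.

(** * Continuity of inverses and absence of poles *)

Section Poles.
Variable R : realType.

(** With [f] convergent, (y - x)^(k+1) f(y) tends to 0, against the nonzero limit required at a
    pole. *)
Lemma cvg_not_real_pole (f : R -> R[i]) (x : R) (l : R[i]) :
  (f y : R[i]^o) @[y --> x^'] --> (l : R[i]^o) -> ~ real_pole f x.
Proof.
move=> fl [k [l' [/eqP l'0 pole]]]; apply: l'0; apply: (cvgC_unique _ pole).
have lim : (((y - x)%:C ^+ k.+1 * f y : R[i]^o) @[y --> x^'] --> (0 * l : R[i]^o)).
  apply: cvgM fl.
  have -> : (0 : R[i]) = (0 : R)%:C by [].
  under eq_fun do rewrite -rmorphXn.
  by apply: cvg_real_complex; apply: cvg_within_filter; exact: cvg_sub_exp.
by rewrite -(mul0r l).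
Qed.

Variables (m : nat) (C : R -> 'M[R[i]]_m.+1) (x : R).
Hypothesis C_cvg : forall i j, (C y i j : R[i]^o) @[y --> x^'] --> (C x i j : R[i]^o).

(** Cramer's rule: the determinant stays nonzero near [x], where the inverse is adj / det. *)
Lemma cvg_invmx n (M : R -> 'M[R[i]]_n) :
    (forall i j, (M y i j : R[i]^o) @[y --> x^'] --> (M x i j : R[i]^o)) ->
    M x \in unitmx ->
  forall i j, (invmx (M y) i j : R[i]^o) @[y --> x^'] --> (invmx (M x) i j : R[i]^o).
Proof.
move=> M_cvg Mx i j; have det_neq0 : \det (M x) != 0 by rewrite -unitfE -unitmxE.
have det_cvg : (\det (M y) : R[i]^o) @[y --> x^'] --> (\det (M x) : R[i]^o).
  exact: (ring_rel_det (@ring_rel_cvg R R x^' _) M_cvg).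
have adj_cvg : ((\adj (M y)) i j : R[i]^o) @[y --> x^'] --> ((\adj (M x)) i j : R[i]^o).
  exact: (ring_rel_adj (@ring_rel_cvg R R x^' _) M_cvg).
have lim : ((\det (M y))^-1 * (\adj (M y)) i j : R[i]^o) @[y --> x^'] -->
    ((\det (M x))^-1 * (\adj (M x)) i j : R[i]^o).
  by apply: cvgM adj_cvg; exact: cvgV.
have -> : invmx (M x) i j = (\det (M x))^-1 * (\adj (M x)) i j.
  by rewrite /invmx Mx [LHS]mxE.
apply: near_cvgC lim; near=> y.
have My : M y \in unitmx.
  rewrite unitmxE unitfE; near: y; exact: (@cvgr_neq0 _ (R[i]^o) _ _ _ _ _ det_cvg).
by rewrite /invmx My [RHS]mxE.
Unshelve. all: by end_near. Qed.

Lemma cvg_resolvent_vector (a : R[i]) j : 1%:M - corner (C x) \in unitmx ->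
  (resolvent_vector (C y) a j 0 : R[i]^o) @[y --> x^'] -->
    (resolvent_vector (C x) a j 0 : R[i]^o).
Proof.
move=> Cx; have cst := @cvg_cst R[i]^o.
have M_cvg k l : ((1%:M - corner (C y)) k l : R[i]^o) @[y --> x^'] -->
    ((1%:M - corner (C x)) k l : R[i]^o).
  rewrite one_sub_cornerE; under eq_fun do rewrite one_sub_cornerE.
  by apply: cvgB; [exact: cst | exact: C_cvg].
have u_cvg k l : (ublock (C y) k l : R[i]^o) @[y --> x^'] --> (ublock (C x) k l : R[i]^o).
  by rewrite !mxE; under eq_fun do rewrite !mxE; exact: C_cvg.
have v_cvg k l := ring_rel_mulmx (@ring_rel_cvg R R x^' _) (cvg_invmx M_cvg Cx) u_cvg k l.
have [_ PD PM] := @ring_rel_cvg R R x^' _.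
(* Replaces an entry by an explicit formula [f], which holds at every [y] and so also identifies the
   limit. *)
have reduce k (f : R -> R[i]) : (forall y, f y = resolvent_vector (C y) a k 0) ->
    (f y : R[i]^o) @[y --> x^'] --> (f x : R[i]^o) ->
    (resolvent_vector (C y) a k 0 : R[i]^o) @[y --> x^'] -->
      (resolvent_vector (C x) a k 0 : R[i]^o).
  by move=> fE; have {fE}-> : f = fun y => resolvent_vector (C y) a k 0 by exact/funext.
case: (unliftP ord0 j) => [j'|] ->; last first.
  apply: (reduce _ (fun=> a)) => [y|]; first by case: (resolvent_vectorE (C y) a).
  exact: cst.
case: (unliftP ord_max j') => [i|] ->.
  apply: (reduce _ (fun y => a * (invmx (1%:M - corner (C y)) *m ublock (C y)) i 0)) => [y|].
    by case: (resolvent_vectorE (C y) a).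
  by apply: PM; [exact: cst | exact: v_cvg].
apply: (reduce _ (fun y => a * (C y ord_max ord0 + \sum_l C y ord_max (lift ord0 l) *
    (invmx (1%:M - corner (C y)) *m ublock (C y)) l 0))) => [y|].
  by case: (resolvent_vectorE (C y) a).
apply: (PM); first exact: cst.
apply: PD; first exact: C_cvg.
apply: (ring_rel_sum (@ring_rel_cvg R R x^' _)) => l.
by apply: PM; [exact: C_cvg | exact: v_cvg].
Qed.

End Poles.

(** * Eigenfunctions *)

Section ExponentialDerivatives.
Variable R : realType.
Implicit Types (a z : R[i]) (lambda x y : R).

Lemma expsum1 a lambda x : expsum [:: (a, lambda)] x = a * e lambda x.
Proof. by rewrite expsum_cons expsum_nil addr0 e_sym. Qed.

Lemma is_derive_Re_exp a lambda x :
  is_derive x (1 : R) (fun y => complex.Re (a * e lambda y))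
    (complex.Re (a * ('i%C * (2 * pi * lambda)%:C) * e lambda x)).
Proof.
have := is_derive_Re_expsum [:: (a, lambda)] x.
by rewrite expsum1; under eq_fun do rewrite expsum1.
Qed.

Lemma is_derive_Im_exp a lambda x :
  is_derive x (1 : R) (fun y => complex.Im (a * e lambda y))
    (complex.Im (a * ('i%C * (2 * pi * lambda)%:C) * e lambda x)).
Proof.
rewrite Im_Re; under eq_fun do rewrite Im_Re.
have := is_derive_Re_exp (- 'i%C * a) lambda x.
by rewrite -!mulrA; under eq_fun do rewrite -mulrA.
Qed.

Lemma cvg_exp a lambda x :
  (a * e lambda y : R[i]^o) @[y --> x] --> (a * e lambda x : R[i]^o).
Proof.
rewrite e_sym; under eq_fun do rewrite e_sym.
exact/is_expsum_cvg/is_expsum_monom.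
Qed.

Local Notation normc := ComplexField.Normc.normc.

Lemma abs_Re_le_normc z : `|complex.Re z| <= normc z.
Proof. by case: z => x y /=; rewrite -sqrtr_sqr ler_wsqrtr // lerDl sqr_ge0. Qed.

Lemma normc_le_ReIm z : normc z <= `|complex.Re z| + `|complex.Im z|.
Proof.
case: z => x y /=; rewrite -[leRHS]ger0_norm ?addr_ge0 // -sqrtr_sqr ler_wsqrtr //.
rewrite sqrrD !real_normK ?num_real // lerD2r lerDl.
by rewrite mulrn_wge0 // mulr_ge0.
Qed.

Lemma normc_e lambda x : normc (e lambda x) = 1.
Proof. by rewrite /e /= cos2Dsin2 sqrtr1. Qed.

(** Mean value theorem, with |e_lambda| = 1 bounding the derivative. *)
Lemma Re_exp_lipschitz a lambda x y : x <= y ->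
  `|complex.Re (a * e lambda y - a * e lambda x)| <=
    normc (a * ('i%C * (2 * pi * lambda)%:C)) * (y - x).
Proof.
move=> xy; rewrite raddfB /=.
have [|c _ ->] := MVT_segment xy (fun t _ => is_derive_Re_exp a lambda t).
  apply: continuous_subspaceT => t.
  have d := is_derive_Re_exp a lambda t.
  by apply: differentiable_continuous; apply/derivable1_diffP; exact: ex_derive.
rewrite normrM [`|y - x|]ger0_norm ?subr_ge0 // ler_wpM2r ?subr_ge0 //.
apply: le_trans (abs_Re_le_normc _) _.
by rewrite ComplexField.Normc.normcM normc_e mulr1.
Qed.

Lemma exp_lipschitz a lambda : exists2 L : R, 0 <= L &
  forall x y, x <= y -> normc (a * e lambda y - a * e lambda x) <= L * (y - x).
Proof.
pose N b := normc (b * ('i%C * (2 * pi * lambda)%:C)).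
have N_ge0 b : 0 <= N b by rewrite /N; case: (b * _) => u v /=; rewrite sqrtr_ge0.
(* The two summands bound the real part and, through -i, the imaginary part. *)
exists (N a + N (- 'i%C * a)) => [|x y xy]; first by rewrite addr_ge0.
apply: le_trans (normc_le_ReIm _) _; rewrite mulrDl lerD ?Re_exp_lipschitz //.
by rewrite Im_Re mulrBr !mulrA Re_exp_lipschitz.
Qed.

End ExponentialDerivatives.

(** * The intervals [J k] and the boundary values of [psi] *)

Section Geometry.
Local Open Scope sesquilinear_scope.
Variables (R : realType) (m : nat) (alpha beta : 'I_m.+1 -> R).
Hypothesis hab : interlaced alpha beta.
Implicit Types (A : 'cV[R[i]]_m.+2) (lambda x : R) (k l : 'I_m.+2).

Local Notation J := (J alpha beta).
Local Notation psi := (psi alpha beta).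
Local Notation Omega := (Omega alpha beta).

(** Induction on [j] along alpha_j < beta_(j+1) < alpha_(j+1). *)
Lemma beta_lt_alpha (i j : 'I_m.+1) : (i <= j)%N -> beta i < alpha j.
Proof.
move: hab => [ba ab]; case: j => j; elim: j => [|j IHj] jm /= ij.
  by rewrite (_ : i = Ordinal jm) //; apply: val_inj; apply/eqP; rewrite -leqn0.
have [->|ij'] := eqVneq i (Ordinal jm); first exact: ba.
have i_le_j : (i <= j)%N by rewrite -ltnS ltn_neqAle ij andbT.
apply: lt_trans (IHj (ltnW jm) i_le_j) (lt_trans (ab _ (Ordinal jm) _) (ba _)) => //.
Qed.

Lemma in_J k x : (x \in J k) =
  (if unlift ord0 k is Some i then alpha i < x else true) &&
  (if unlift ord_max k is Some i then x < beta i else true).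
Proof.
by rewrite /Defs.J; case: (unlift ord0 k) => [i|]; case: (unlift ord_max k) => [j|];
  rewrite in_itv ?andbT.
Qed.

(** Writing k = i and l = j + 1, [J k] ends at [beta i] and [J l] begins at [alpha j], where i <=
    j. *)
Lemma J_lt_disjoint k l x : (k < l)%N -> x \in J k -> x \in J l -> False.
Proof.
move=> kl; rewrite !in_J => /andP[_ xk] /andP[xl _]; move: xk xl kl.
case: (unliftP ord_max k) => [i|] ->; last by rewrite ltnNge leq_ord.
case: (unliftP ord0 l) => [j|] -> // xi xj; rewrite lift0 lift_max ltnS => ij.
by have := lt_trans (lt_trans xj xi) (beta_lt_alpha ij); rewrite ltxx.
Qed.

Lemma J_inj k l x : x \in J k -> x \in J l -> k = l.
Proof.
move=> xk xl; apply/val_inj; case: (ltngtP k l) => // kl.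
  by case: (J_lt_disjoint kl xk xl).
by case: (J_lt_disjoint kl xl xk).
Qed.

Lemma psiE A lambda k x : x \in J k -> psi A lambda x = A k 0 * e lambda x.
Proof.
move=> xk; rewrite /Defs.psi (bigD1 k) //= xk mulr1 big1 ?addr0 // => l lk.
case: (boolP (x \in J l)) => [xl|]; last by rewrite mulr0.
by rewrite (J_inj xl xk) eqxx in lk.
Qed.

Lemma scale_psi (a : R[i]) A lambda x : a * psi A lambda x = psi (a *: A) lambda x.
Proof.
rewrite /Defs.psi mulrA mulr_sumr; congr (_ * _); apply: eq_bigr => k _.
by rewrite mxE mulrA.
Qed.

Lemma J_open k : open [set` J k].
Proof.
rewrite /Defs.J.
by case: (unlift ord0 k) => [i|]; case: (unlift ord_max k) => [j|]; exact: interval_open.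
Qed.

Lemma near_J k x : x \in J k -> \forall y \near x, y \in J k.
Proof. by move=> xk; apply: (@open_nbhs_nbhs _ x [set` J k]); split; first exact: J_open. Qed.

(** [lift ord_max i], of value i, indexes the interval ending at [beta i]; likewise [lift ord0 i],
    of value i + 1, the one beginning at [alpha i]. *)
Lemma near_J_left (i : 'I_m.+1) :
  \forall y \near (beta i)^'-, y \in J (lift ord_max i).
Proof.
case: (unliftP ord0 (lift ord_max i)) => [j|] iE; near=> y; rewrite in_J liftK iE.
  rewrite liftK; apply/andP; split; near: y; last exact: nbhs_left_lt.
  by apply: nbhs_left_gt; apply: hab.2; have := congr1 (@nat_of_ord _) iE; rewrite lift_max lift0.
by rewrite unlift_none /=; near: y; exact: nbhs_left_lt.
Unshelve. all: by end_near. Qed.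

Lemma near_J_right (i : 'I_m.+1) :
  \forall y \near (alpha i)^'+, y \in J (lift ord0 i).
Proof.
case: (unliftP ord_max (lift ord0 i)) => [j|] iE; near=> y; rewrite in_J liftK iE.
  rewrite liftK; apply/andP; split; near: y; first exact: nbhs_right_gt.
  by apply: nbhs_right_lt; apply: hab.2; have := congr1 (@nat_of_ord _) iE; rewrite lift_max lift0.
by rewrite unlift_none andbT; near: y; exact: nbhs_right_gt.
Unshelve. all: by end_near. Qed.

Lemma psi_cvg_left A lambda (i : 'I_m.+1) :
  cvg_left (psi A lambda) (beta i) ((D beta lambda *m row' ord_max A) i 0).
Proof.
rewrite mul_diag_mx mxE mxE row'E mulrC.
apply: (near_cvgC (f := fun x => A (lift ord_max i) 0 * e lambda x)).
  by have := near_J_left i; apply: filterS => x xk; rewrite (psiE _ _ xk).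
by apply: cvg_within_filter; exact: cvg_exp.
Qed.

Lemma psi_cvg_right A lambda (i : 'I_m.+1) :
  cvg_right (psi A lambda) (alpha i) ((D alpha lambda *m row' ord0 A) i 0).
Proof.
rewrite mul_diag_mx mxE mxE row'E mulrC.
apply: (near_cvgC (f := fun x => A (lift ord0 i) 0 * e lambda x)).
  by have := near_J_right i; apply: filterS => x xk; rewrite (psiE _ _ xk).
by apply: cvg_within_filter; exact: cvg_exp.
Qed.

(** By uniqueness of limits the boundary values are D_beta (A_0, ..., A_(n-1)) and D_alpha (A_1,
    ..., A_n); the unitary D_alpha is then moved to the other side. *)
Lemma psi_boundary_condition B A lambda :
  boundary_condition alpha beta B (psi A lambda) <-> solution alpha beta B lambda A.
Proof.
have DD : (D alpha lambda)^t* *m D alpha lambda = 1%:M.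
  by apply: mulmx1C; apply/unitarymxP; exact: D_unitary.
have DD' : D alpha lambda *m (D alpha lambda)^t* = 1%:M.
  by apply/unitarymxP; exact: D_unitary.
rewrite /solution /Bab; split=> [[fb [fa [fbE faE Bf]]]|sol].
  have -> : row' ord0 A = (D alpha lambda)^t* *m fa.
    rewrite -[LHS]mul1mx -DD -mulmxA; congr (_ *m _); apply/colP => i.
    exact: (cvgC_unique _ (@psi_cvg_right A lambda i) (faE i)).
  rewrite -Bf -!mulmxA; do 2! congr (_ *m _); apply/colP => i.
  exact: (cvgC_unique _ (@psi_cvg_left A lambda i) (fbE i)).
exists (D beta lambda *m row' ord_max A), (D alpha lambda *m row' ord0 A); split.
- exact: psi_cvg_left.
- exact: psi_cvg_right.
by rewrite -sol !mulmxA DD' mul1mx.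
Qed.

End Geometry.

(** * [psi] as a square integrable eigenfunction *)

Section Eigenfunctions.
Variables (R : realType) (m : nat) (alpha beta : 'I_m.+1 -> R).
Hypothesis hab : interlaced alpha beta.
Variable lambda : R.
Implicit Types (A : 'cV[R[i]]_m.+2) (x : R).

Local Notation J := (J alpha beta).
Local Notation psi A := (psi alpha beta A lambda).
Local Notation Omega := (Omega alpha beta).
Local Notation normc := ComplexField.Normc.normc.
Local Notation freq := ('i%C * (2 * pi * lambda)%:C).

Lemma Omega_open : open Omega.
Proof. by apply: bigcup_open => k _; exact: J_open. Qed.

(** Near a point of [J k], [psi] is the single exponential A_k e_lambda, so differentiation
    multiplies each coefficient by [freq]. *)
Lemma is_derive_psi A x : Omega x ->
  is_derive x (1 : R) (fun y => complex.Re (psi A y)) (complex.Re (psi (freq *: A) x)) /\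
  is_derive x (1 : R) (fun y => complex.Im (psi A y)) (complex.Im (psi (freq *: A) x)).
Proof.
move=> [k _ /= xk]; rewrite (psiE hab _ _ xk) mxE [freq * _]mulrC.
have psi_k : \forall y \near x, A k 0 * e lambda y = psi A y.
  by have := near_J xk; apply: filterS => y yk; rewrite (psiE hab _ _ yk).
split.
  apply: near_eq_is_derive (is_derive_Re_exp (A k 0) lambda x).
  by move: psi_k; apply: filterS => y ->.
apply: near_eq_is_derive (is_derive_Im_exp (A k 0) lambda x).
by move: psi_k; apply: filterS => y ->.
Qed.

Lemma psi_ae_derivative A : ae_derivative alpha beta (psi A) (psi (freq *: A)).
Proof. by apply: aeW => x; exact: is_derive_psi. Qed.

Lemma measurable_Re_psi A : measurable_fun Omega (fun x => complex.Re (psi A x)).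
Proof.
apply: open_continuous_measurable_fun; first exact: Omega_open.
move=> x /set_mem /is_derive_psi - /(_ A)[d _].
by apply: differentiable_continuous; apply/derivable1_diffP; exact: ex_derive.
Qed.

Lemma measurable_Im_psi A : measurable_fun Omega (fun x => complex.Im (psi A x)).
Proof.
apply: open_continuous_measurable_fun; first exact: Omega_open.
move=> x /set_mem /is_derive_psi - /(_ A)[_ d].
by apply: differentiable_continuous; apply/derivable1_diffP; exact: ex_derive.
Qed.

(** On Omega, |psi|^2 is at most [C] inside the bounded interval [S] and zero outside it. *)
Lemma psi_square_integrable A : A ord0 0 = 0 -> A ord_max 0 = 0 ->
  square_integrable alpha beta (psi A).
Proof.
move=> A0 Am; split; [exact: measurable_Re_psi | exact: measurable_Im_psi |].
pose S := [set` `]beta ord0, alpha ord_max[]; pose C := \sum_k normc (A k 0) ^+ 2.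
have mOmega : measurable Omega by apply: open_measurable; exact: Omega_open.
have mS : measurable S by exact: measurable_itv.
have normcE z : normc z ^+ 2 = complex.Re z ^+ 2 + complex.Im z ^+ 2 :> R.
  by case: z => a b /=; rewrite sqr_sqrtr // addr_ge0 // sqr_ge0.
have C_ge0 : 0 <= C by apply: sumr_ge0 => k _; exact: sqr_ge0.
apply: (@le_lt_trans _ _ (\int[@lebesgue_measure R]_(x in Omega) (C * \1_S x)%:E)%E).
  apply: ge0_le_integral => //.
  - by move=> x _; rewrite lee_fin sqr_ge0.
  - apply/measurable_EFinP; under eq_fun do rewrite normcE.
    by apply: measurable_funD; apply: measurable_funX;
      [exact: measurable_Re_psi | exact: measurable_Im_psi].
  - apply/measurable_EFinP; apply: measurable_funM; first exact: measurable_cst.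
    exact: measurable_indic.
  move=> x [k _ /= xk]; rewrite lee_fin (psiE hab _ _ xk) ComplexField.Normc.normcM normc_e mulr1.
  have [xS|xS] := boolP (x \in S).
    by rewrite indicE xS mulr1 /C (bigD1 k) //= lerDl sumr_ge0 // => l _; exact: sqr_ge0.
  (* Only the two unbounded intervals contain points outside [S], and their coefficients vanish. *)
  suff -> : A k 0 = 0.
    by rewrite ComplexField.Normc.normc0 expr0n mulr_ge0.
  move: xk; rewrite in_J => /andP[].
  case: (unliftP ord0 k) => [i ki xi|->]; last by rewrite A0.
  case: (unliftP ord_max k) => [j kj xj|-> //]; case/negP: xS; apply/mem_set.
  by rewrite /S /= in_itv /= (lt_trans (beta_lt_alpha hab (leq0n _ : ord0 <= i)%N) xi)
    (lt_trans xj (beta_lt_alpha hab (leq_ord _ : j <= @ord_max m)%N)).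
have -> : (\int[@lebesgue_measure R]_(x in Omega) (C * \1_S x)%:E =
    C%:E * \int[@lebesgue_measure R]_(x in Omega) (\1_S x)%:E)%E.
  apply: (@integralZl_indic _ _ R (@lebesgue_measure R) _ mOmega (fun=> S) C);
    last exact: mS.
  by move=> C0; rewrite ltNge C_ge0 in C0.
rewrite integral_indic //.
apply: lte_mul_pinfty; rewrite ?lee_fin //.
apply: le_lt_trans (_ : lebesgue_measure S < +oo)%E.
  apply: le_measure; [|exact/mem_set|exact: subIsetl].
  by apply/mem_set; exact: measurableI.
by rewrite lebesgue_measure_itv /=; case: ifP; rewrite // -EFinD ltry.
Qed.

Lemma psi_abs_continuous A k : abs_continuous (J k) (psi A).
Proof.
move=> eps eps_gt0; have [L L_ge0 lipL] := exp_lipschitz (A k 0) lambda.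
(* [psi] is [L]-Lipschitz on [J k]; the added 1 keeps the divisor positive when L = 0. *)
exists (eps / (L + 1)) => [|N a b abJ _]; first by rewrite divr_gt0 // ltr_wpDl.
rewrite ltr_pdivlMr ?ltr_wpDl // => sum_lt; apply: le_lt_trans sum_lt.
rewrite mulr_suml; apply: ler_sum => i _; have [ai bi ab] := abJ i.
rewrite (psiE hab _ _ ai) (psiE hab _ _ bi); apply: le_trans (lipL _ _ ab) _.
by rewrite mulrC ler_wpM2l ?subr_ge0 // lerDl.
Qed.

(** The index is that of a bounded interval. There [psi] has no zero, and the positive length of the
    interval excludes a null set. *)
Lemma psi_ae_neq0 A i : A (lift ord0 (lift ord_max i)) 0 != 0 ->
  ~ {ae @lebesgue_measure R, forall x, Omega x -> psi A x = 0}.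
Proof.
set k := lift _ _ => Ak [N [mN N0 psiN]].
have JN : [set` J k] `<=` N.
  move=> x xk; apply: psiN => /= psi0; have := psi0 (ex_intro2 _ _ k I xk).
  by apply/eqP; rewrite (psiE hab _ _ xk) mulf_neq0 // e_neq0.
have JE : J k = `]alpha (lift ord_max i), beta (lift ord0 i)[.
  by rewrite /Defs.J /k liftK -lift_max_lift0 liftK.
have ab : alpha (lift ord_max i) < beta (lift ord0 i).
  by apply: hab.2; rewrite lift_max lift0.
have : (lebesgue_measure [set` J k] <= 0 :> \bar R)%E.
  by rewrite -N0; apply: le_measure; rewrite ?inE.
by rewrite JE lebesgue_measure_itv /= lte_fin ab -EFinD lee_fin subr_le0 leNgt ab.
Qed.

Lemma psi_PB_eigenvalue B A i :
    A ord0 0 = 0 -> A ord_max 0 = 0 -> A (lift ord0 (lift ord_max i)) 0 != 0 ->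
    solution alpha beta B lambda A ->
  PB_eigenvalue alpha beta B lambda.
Proof.
move=> A0 Am Ak sol; exists (psi A); split; last exact: psi_ae_neq0 Ak.
(* The derivative prescribed by P_B psi = lambda psi is the actual one. *)
have PsiE : (fun x => (2 * pi)%:C * 'i * (lambda%:C * psi A x)) = psi (freq *: A).
  apply/funext => x; rewrite -scale_psi !rmorphM.
  have -> : Num.imaginary = 'i%C :> R[i] by [].
  ring.
split; last by rewrite PsiE; exact: psi_ae_derivative.
split; first exact: psi_square_integrable.
- exact: psi_abs_continuous.
- exists (psi (freq *: A)); last exact: psi_ae_derivative.
  by apply: psi_square_integrable; rewrite mxE ?A0 ?Am mulr0.
- exact/(psi_boundary_condition hab).
Qed.

End Eigenfunctions.

(** * Solutions, poles and eigenvalues of the boundary problem *)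

Theorem theorem3p9 (R : realType) (m : nat) (hm : (2 < m.+1)%N)
    (alpha beta : 'I_m.+1 -> R) (hab : interlaced alpha beta)
    (B : 'M[R[i]]_m.+1) (hB : B \is unitarymx) :
  let Bl := Bab alpha beta B in
  let M := fun lambda => 1%:M - corner (Bl lambda) in
  let u := fun lambda => ublock (Bl lambda) in
  let c := fun lambda => cblock (Bl lambda) in
  let w := fun lambda => wblock (Bl lambda) in
  let Lp := Lambda_p alpha beta B in
  (* the coefficients of a generalized eigenfunction solve the system *)
  (forall (lambda : R) (A : 'cV[R[i]]_m.+2),
     boundary_condition alpha beta B (psi alpha beta A lambda) ->
     solution alpha beta B lambda A) /\
  (* (1) *)
  (Lp = set0 ->
     (forall lambda : R,
        non_degenerate (Bl lambda) /\
        forall A : 'cV[R[i]]_m.+2,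
          solution alpha beta B lambda A <->
          exists x0 : R[i], A = resolvent_vector (Bl lambda) x0) /\
     (forall x0 : R[i],
        Lp = [set lambda | exists j, real_pole
               (fun mu => resolvent_vector (Bl mu) x0 j 0) lambda])) /\
  (* the functions of (1) and their real poles, without assuming Lp = set0 *)
  (forall lambda : R, ~ Lp lambda ->
     non_degenerate (Bl lambda) /\
     forall A : 'cV[R[i]]_m.+2,
       solution alpha beta B lambda A <->
       exists x0 : R[i], A = resolvent_vector (Bl lambda) x0) /\
  (forall (x0 : R[i]) (j : 'I_m.+2) (lambda : R),
     real_pole (fun mu => resolvent_vector (Bl mu) x0 j 0) lambda ->
     Lp lambda) /\
  Lp = [set lambda | exists i j,
          real_pole (fun mu => invmx (M mu) i j) lambda] /\
  (* (2) *)
  (Lp !=set0 ->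
     forall lambda : R, Lp lambda ->
       [/\ degenerate (Bl lambda),
           exists2 zeta : 'cV[R[i]]_m, zeta != 0 & M lambda *m zeta = 0,
           (* (a) *)
           (~ exists zeta0 : 'cV[R[i]]_m, M lambda *m zeta0 = u lambda) ->
             forall A : 'cV[R[i]]_m.+2,
               solution alpha beta B lambda A <->
               exists2 zeta : 'cV[R[i]]_m, M lambda *m zeta = 0 &
                 A = stack 0 zeta (inner (w lambda) zeta),
           (* (b) *)
           forall zeta0 : 'cV[R[i]]_m, M lambda *m zeta0 = u lambda ->
             forall A : 'cV[R[i]]_m.+2,
               solution alpha beta B lambda A <->
               exists (x0 : R[i]) (zeta : 'cV[R[i]]_m),
                 M lambda *m zeta = 0 /\
                 A = x0 *: stack 1 zeta0
                                 (c lambda + inner (w lambda) zeta0)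
                     + stack 0 zeta (inner (w lambda) zeta) &
           PB_eigenvalue alpha beta B lambda]).
Proof.
move=> Bl M u c w Lp.
have M_unit mu : (M mu \in unitmx) = (\det (M mu) != 0) by rewrite unitmxE unitfE.
have regular lambda : ~ Lp lambda -> non_degenerate (Bl lambda) /\
    forall A : 'cV[R[i]]_m.+2, solution alpha beta B lambda A <->
      exists x0 : R[i], A = resolvent_vector (Bl lambda) x0.
  move=> /eqP det_neq0; split.
    by split; [exact: Bab_unitary | rewrite eigenvalue_corner].
  by move=> A; apply: regular_solution; rewrite -/(M lambda) M_unit.
have pole_Lp x0 j lambda :
    real_pole (fun mu => resolvent_vector (Bl mu) x0 j 0) lambda -> Lp lambda.
  move=> pole; apply: contrapT => /eqP det_neq0.
  apply: (cvg_not_real_pole _ pole); apply: (cvg_resolvent_vector (C := Bl)).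
    move=> i k; apply: cvg_within_filter.
    exact: (is_expsum_cvg (Bab_is_expsum alpha beta B i k)).
  by rewrite -/(M lambda) M_unit.
split; first by move=> lambda A /(psi_boundary_condition hab).
split.
  move=> Lp0; split=> [lambda|x0]; first by apply: regular; rewrite Lp0.
  (* Both sets are empty here, since a pole could only lie in [Lp]. *)
  by apply/seteqP; split=> lambda; [rewrite Lp0 | move=> [j /pole_Lp]].
split; first exact: regular.
split; first exact: pole_Lp.
split.
  (* Zeros of the determinant are poles of the inverse; at all other points the inverse is
     continuous. *)
  apply/seteqP; split=> lambda.
    by move=> det0; apply: invmx_pole => //;
      [exact: one_sub_corner_is_expsum | exact: det_constant_term].
  move=> [i [j pole]]; apply: contrapT => /eqP det_neq0.
  apply: (cvg_not_real_pole _ pole); apply: (cvg_invmx (M := M)); last by rewrite M_unit.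
  move=> k l; apply: cvg_within_filter.
  exact: (is_expsum_cvg (one_sub_corner_is_expsum alpha beta B k l)).
move=> _ lambda det0.
have [zeta zeta_neq0 Mzeta] : exists2 zeta : 'cV[R[i]]_m, zeta != 0 & M lambda *m zeta = 0.
  (* [det0P] yields a row vector in a left kernel; transposing gives a column in the kernel of
     [M lambda]. *)
  have /eqP/det0P[v v_neq0 vM] : \det (M lambda)^T = 0 by rewrite det_tr.
  exists v^T; first by apply: contraNneq v_neq0 => v0; rewrite -[v]trmxK v0 trmx0.
  by apply: trmx_inj; rewrite trmx_mul trmxK trmx0.
split.
- by split; [exact: Bab_unitary | rewrite eigenvalue_corner; exact/eqP].
- by exists zeta.
- by move=> nex A; exact: singular_solution_out.
- by move=> zeta0 zeta0E A; exact: singular_solution_in.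
(* The kernel vector [zeta] gives a solution with A_0 = 0. *)
have sol := (solution_stackP (Bl lambda) (stack 0 zeta (inner (wblock (Bl lambda)) zeta))).2.
have {}sol : solution alpha beta B lambda (stack 0 zeta (inner (w lambda) zeta)).
  by apply: sol; exists 0, zeta; rewrite mulr0 add0r scale0r.
have [i zeta_i] : exists i, zeta i 0 != 0.
  apply: contrapT => /forallNP zeta0; case/eqP: zeta_neq0; apply/colP => i.
  by rewrite mxE; apply/eqP/negPn/negP.
apply: (psi_PB_eigenvalue hab _ _ _ sol); last by rewrite stack_mid; exact: zeta_i.
  exact: stack_first.
(* Unitarity forces |A_n| = |A_0| = 0, so both unbounded intervals drop out. *)
have := unitary_solution (Bab_unitary alpha beta lambda hB) sol.
by rewrite stack_first normr0 => /esym /normr0_eq0.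
Qed.
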